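(* The following sets, together with the listed operations as addition and multiplication respectively, form commutative semirings: (1) the set $\mathrm{PU}$ of strict isomorphism classes of P\'olya urns, with disjoint union $\sqcup$ as addition and product $\times$ as multiplication; (2) the set $\mathrm{IntMat}_p$ of equivalence classes of intensity matrices under permutation similarity, with direct sum $\oplus$ as addition and Kronecker sum $\boxplus$ as multiplication; (3) the set $\mathrm{fmSet}_{\mathbb C}$ of finite multisets of complex numbers, with disjoint union as addition and Minkowski sum as multiplication. Moreover, there are morphisms $\Phi$ and $\sigma$ of semirings $$\mathrm{PU}\xrightarrow{\ \Phi\ }\mathrm{IntMat}_p\xrightarrow{\ \sigma\ }\mathrm{fmSet}_{\mathbb C},$$ where $\Phi$ assigns to an isomorphism class of P\'olya urns its equivalence class of intensity matrices, and $\sigma$ maps an equivalence class of intensity matrices to the spectrum of a representative.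
   Context: Semirings. A commutative semiring is a set with two commutative, associative operations $+,\cdot$ with neutral elements $0$ and $1$, such that $\cdot$ distributes over $+$ and $0\cdot x=0$ for all $x$. A morphism of semirings preserves $+$, $\cdot$, $0$ and $1$. P\'olya urns. For a finite set $Q$, $\mathbb Z^Q$ is the free $\mathbb Z$-module on $Q$ (functions $Q\to\mathbb Z$). A map $\varphi:Q\to Q'$ induces the linear map $\hat\varphi:\mathbb Z^Q\to\mathbb Z^{Q'}$ sending the basis vector of $i$ to the basis vector of $\varphi(i)$; $\hat\varphi_*\nu$ is the push-forward of a measure $\nu$ under $\hat\varphi$. A (generalised) P\'olya urn is a tuple $\mathcal U=(Q,\mu=(\mu_i)_{i\in Q},a,X(0))$, where $Q$ is a finite set (possibly empty; its elements are the colours), each $\mu_i$ is a probability measure on $\mathbb Z^Q$ (with the power set $\sigma$-algebra) supported within $\{x\in\mathbb Z^Q: x_j\ge-\delta_{ij}\ \forall j\in Q\}$, $a:Q\to\mathbb R_{\ge0}$ (activities), and $X(0):Q\to\mathbb Z_{\ge0}$ (initial configuration), such that $\mu_i=\delta_0$ (Dirac measure at $0$) whenever $a_i=0$. Urns $\mathcal U$ and $\mathcal U'=(Q',\mu',a',X'(0))$ are strictly isomorphic if there is a bijection $\varphi:Q\to Q'$ with $\mu'_{\varphi(i)}=\hat\varphi_*\mu_i$, $a'_{\varphi(i)}=a_i$ and $X'_{\varphi(i)}(0)=X_i(0)$ for all $i\in Q$. Disjoint union. $\mathcal U\sqcup\mathcal U'$ has colour set $Q\sqcup Q'$, activity equal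 to $a$ on $Q$ and $a'$ on $Q'$, initial configuration equal to $X(0)$ on $Q$ and $X'(0)$ on $Q'$, and replacement measures $(\hat\iota_Q)_*\mu_i$ for $i\in Q$ and $(\hat\iota_{Q'})_*\mu'_i$ for $i\in Q'$, where $\iota_Q,\iota_{Q'}$ are the canonical injections into $Q\sqcup Q'$. Product. $\mathcal U\times\mathcal U'$ has colour set $Q\times Q'$, activities $a^\times_{(i,j)}=a_i+a'_j$, initial configuration $X^\times_{(i,j)}(0)=X_i(0)X'_j(0)$, and replacement measures $$\mu^\times_{(i,j)}=\frac{a_i}{a_i+a'_j}(\widehat{\kappa_Q})_*\mu_i+\frac{a'_j}{a_i+a'_j}(\widehat{\kappa_{Q'}})_*\mu'_j\quad\text{if }a_i+a'_j>0,$$ and $\mu^\times_{(i,j)}=\delta_0$ if $a_i+a'_j=0$, where (for the given $(i,j)$) $\kappa_Q:Q\to Q\times Q'$, $k\mapsto(k,j)$ and $\kappa_{Q'}:Q'\to Q\times Q'$, $k\mapsto(i,k)$. These operations are applied to classes in $\mathrm{PU}$ via representatives. Intensity matrix. For an urn $\mathcal U$ with $Q=\{1,\dots,q\}$ (after choosing an enumeration of the colours) and $\xi_i=(\xi_{i,j})_{j\in Q}$ a $\mu_i$-distributed random vector, the intensity matrix is the $q\times q$ matrix $A$ with entries $A_{ij}=a_j\,\mathbf E[\xi_{j,i}]$. Matrices. $\mathrm{IntMat}$ is the set of all real square matrices $A$ of any size $q\ge0$ with $A_{ij}\ge0$ whenever $i\ne j$; these are the intensity matrices meant in (2). Two $q\times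 q$ matrices $B,C$ are permutation similar, $B\sim_pC$, if $C=P^{-1}BP$ for some permutation matrix $P$, and $\mathrm{IntMat}_p=\mathrm{IntMat}/\sim_p$. $A\oplus B$ is the block diagonal matrix with blocks $A,B$; for $A$ of size $n$ and $B$ of size $m$, $A\boxplus B=A\otimes I_m+I_n\otimes B$ with $\otimes$ the Kronecker product and $I_k$ the identity matrix of size $k$. Operations on classes are via representatives. Multisets. A finite multiset of complex numbers is a finitely supported map $m:\mathbb C\to\mathbb N_0$. The disjoint union of $m,m'$ is the pointwise sum $z\mapsto m(z)+m'(z)$; their Minkowski sum is the multiset of all pairwise sums with multiplicity, $z\mapsto\sum_{w\in\mathbb C}m(w)m'(z-w)$. The spectrum of a square matrix is regarded as the finite multiset of its complex eigenvalues, counted with algebraic multiplicity.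
   Formalization: Φ is defined only on classes of urns whose replacement vectors have finite means, shown to be a subsemiring of PU, since an urn with an infinite mean has no real intensity matrix; part (1) is for all urns. *)

(* Defs.v *)
From HB Require Import structures.
From mathcomp Require Import all_boot all_order all_algebra.
From mathcomp Require Import finmap multiset.
From mathcomp Require Import all_classical all_reals all_analysis.
From mathcomp Require Import complex mxtens.
Set Implicit Arguments.
Unset Strict Implicit.
Unset Printing Implicit Defensive.
Import Order.TTheory GRing.Theory Num.Theory.
Local Open Scope classical_set_scope.
Local Open Scope ring_scope.
Local Open Scope complex_scope.

(* Not MathComp's [comPzSemiRingType]: that one requires a choice structure, and
   the type of urns quantifies over all of [finType], so it lives in a universe
   too large for the MathComp hierarchy. *)
Record comm_semiring (T : Type) := CommSemiring {
  sadd : T -> T -> T;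
  smul : T -> T -> T;
  szero : T;
  sone : T;
  saddA : associative sadd;
  saddC : commutative sadd;
  sadd0 : left_id szero sadd;
  smulA : associative smul;
  smulC : commutative smul;
  smul1 : left_id sone smul;
  smulDl : left_distributive smul sadd;
  smul0 : left_zero szero smul }.

Record semiring_morphism (T T' : Type) (S : comm_semiring T)
    (S' : comm_semiring T') (f : T -> T') : Prop := SemiringMorphism {
  smorphD : {morph f : x y / sadd S x y >-> sadd S' x y};
  smorphM : {morph f : x y / smul S x y >-> smul S' x y};
  smorph0 : f (szero S) = szero S';
  smorph1 : f (sone S) = sone S' }.

(* The quotient of [T] by an equivalence [e]: equivalence classes as predicates. *)
Definition quot (T : Type) (e : T -> T -> Prop) : Type :=
  {C : T -> Prop | exists x, C = e x}.

Definition cls (T : Type) (e : T -> T -> Prop) (x : T) : quot e :=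
  exist _ (e x) (ex_intro _ x erefl).

Definition zvec (Q : finType) := {ffun Q -> int}.

HB.instance Definition _ (Q : finType) := GRing.Zmodule.on (zvec Q).
HB.instance Definition _ (Q : finType) := isPointed.Build (zvec Q) 0.
HB.instance Definition _ (Q : finType) :=
  @isMeasurable.Build default_measure_display (zvec Q)
    discrete_measurable discrete_measurable0
    discrete_measurableC discrete_measurableU.

(* The linear map sending the basis vector of [i] to that of [phi i]. *)
Definition zmap (Q Q' : finType) (phi : Q -> Q') (x : zvec Q) : zvec Q' :=
  [ffun j => \sum_(i | phi i == j) x i].

Section ZPush.
Context (R : realType) (Q Q' : finType).
Variables (phi : Q -> Q') (mu : probability (zvec Q) R).

Definition zpush : set (zvec Q') -> \bar R := pushforward mu (zmap phi).

Let zpush0 : zpush set0 = 0%E.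
Proof. by rewrite /zpush /pushforward preimage_set0 measure0. Qed.

Let zpush_ge0 A : (0 <= zpush A)%E.
Proof. exact: measure_ge0. Qed.

Let zpush_sigma_additive : semi_sigma_additive zpush.
Proof.
move=> F mF tF mUF; rewrite /zpush /pushforward preimage_bigcup.
apply: measure_semi_sigma_additive => //.
apply/trivIsetP => /= i j _ _ ij; rewrite -preimage_setI.
by move/trivIsetP : tF => /(_ _ _ _ _ ij) ->//; rewrite preimage_set0.
Qed.

HB.instance Definition _ :=
  isMeasure.Build _ _ _ zpush zpush0 zpush_ge0 zpush_sigma_additive.

Let zpushT : zpush setT = 1%E.
Proof. by rewrite /zpush /pushforward preimage_setT probability_setT. Qed.

HB.instance Definition _ := Measure_isProbability.Build _ _ _ zpush zpushT.

End ZPush.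

(* The replacement measure of the colour (i, j) in a product of urns, where [a]
   and [b] are the activities of i and j. *)
Section ZMixture.
Context (R : realType) (Q : finType).
Variables (a b : {nonneg R}) (mu nu : probability (zvec Q) R).

Definition zmixture : set (zvec Q) -> \bar R := fun A =>
  if 0 < a%:num + b%:num then
    ((a%:num / (a%:num + b%:num))%:E * mu A +
     (b%:num / (a%:num + b%:num))%:E * nu A)%E
  else \d_(0 : zvec Q) A.

Let zmixture0 : zmixture set0 = 0%E.
Proof.
by rewrite /zmixture; case: ifP => _; rewrite ?measure0// !mule0 adde0.
Qed.

Let zmixture_ge0 A : (0 <= zmixture A)%E.
Proof.
rewrite /zmixture; case: ifP => // _.
by rewrite adde_ge0// mule_ge0// lee_fin divr_ge0.
Qed.

Let zmixture_sigma_additive : semi_sigma_additive zmixture.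
Proof.
rewrite /zmixture; case: (0 < _); last exact: measure_semi_sigma_additive.
have p0 : 0 <= a%:num / (a%:num + b%:num) by rewrite divr_ge0.
have q0 : 0 <= b%:num / (a%:num + b%:num) by rewrite divr_ge0.
rewrite (_ : (fun A => _) =
  measure_add (mscale (NngNum p0) mu) (mscale (NngNum q0) nu)); last first.
  by apply/funext => A; rewrite measure_addE.
exact: measure_semi_sigma_additive.
Qed.

HB.instance Definition _ :=
  isMeasure.Build _ _ _ zmixture zmixture0 zmixture_ge0 zmixture_sigma_additive.

Let zmixtureT : zmixture setT = 1%E.
Proof.
rewrite /zmixture; case: ifP => [ab0|_]; last exact: diracT.
by rewrite !probability_setT !mule1 -EFinD -mulrDl divff// gt_eqF.
Qed.

HB.instance Definition _ := Measure_isProbability.Build _ _ _ zmixture zmixtureT.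

End ZMixture.

Record urn (R : realType) := Urn {
  colour : finType;
  repl : colour -> probability (zvec colour) R;
  activity : colour -> {nonneg R};
  init : colour -> nat;
  repl_supp : forall i,
    repl i [set x : zvec colour | forall j, - (i == j)%:Z <= x j] = 1%E;
  repl_inactive : forall i, (activity i)%:num = 0 ->
    forall A, repl i A = \d_(0 : zvec colour) A }.

Definition strict_iso (R : realType) (U V : urn R) : Prop :=
  exists2 phi : colour U -> colour V, bijective phi &
    forall i, [/\ forall A, repl (phi i) A = zpush phi (repl i) A,
                  (activity (phi i))%:num = (activity i)%:num
                & init (phi i) = init i].

Definition PU (R : realType) : Type := quot (@strict_iso R).

Definition urn_class (R : realType) (U : urn R) : PU R := cls (@strict_iso R) U.

Lemma probability_zvec_sub (R : realType) (Q : finType)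
    (mu : probability (zvec Q) R) (A B : set (zvec Q)) :
  A `<=` B -> mu A = 1%E -> mu B = 1%E.
Proof.
move=> AB muA; apply/eqP; rewrite eq_le probability_le1//= -muA.
by rewrite le_measure// inE.
Qed.

Lemma zpush_supp (R : realType) (Q Q' : finType) (phi : Q -> Q')
    (mu : probability (zvec Q) R) (i : Q) : injective phi ->
  mu [set x : zvec Q | forall j, - (i == j)%:Z <= x j] = 1%E ->
  zpush phi mu [set x : zvec Q' | forall j, - (phi i == j)%:Z <= x j] = 1%E.
Proof.
move=> phiI; apply: probability_zvec_sub => x /= xP j; rewrite ffunE.
have [k kj|phij] := pickP (fun k => phi k == j); last first.
  by rewrite big_pred0// oppr_le0.
rewrite (big_pred1 k) => [|l]; first by rewrite -(eqP kj) (inj_eq phiI).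
by rewrite -(eqP kj) (inj_eq phiI).
Qed.

Lemma zpush_dirac0 (R : realType) (Q Q' : finType) (phi : Q -> Q')
    (mu : probability (zvec Q) R) :
  (forall A, mu A = \d_(0 : zvec Q) A) ->
  forall A, zpush phi mu A = \d_(0 : zvec Q') A.
Proof.
move=> mu0 A; rewrite /zpush /pushforward mu0 !diracE; congr (_%:R%:E).
suff zmap0 : zmap phi 0 = 0.
  by congr nat_of_bool; rewrite -[in RHS]zmap0; apply/idP/idP; rewrite !inE.
by apply/ffunP => j; rewrite !ffunE big1// => i _; rewrite ffunE.
Qed.

Section UrnSum.
Context (R : realType).
Variables U V : urn R.

Local Notation Q := (colour U + colour V)%type.

Definition urn_sum_repl (c : Q) : probability (zvec Q) R :=
  match c with
  | inl i => zpush inl (repl i)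
  | inr j => zpush inr (repl j)
  end.

Definition urn_sum_activity (c : Q) : {nonneg R} :=
  match c with inl i => activity i | inr j => activity j end.

Definition urn_sum_init (c : Q) : nat :=
  match c with inl i => init i | inr j => init j end.

Let supp c :
  urn_sum_repl c [set x : zvec Q | forall d, - (c == d)%:Z <= x d] = 1%E.
Proof.
by case: c => c; apply: zpush_supp; try exact: repl_supp; move=> ? ? [].
Qed.

Let inactive c : (urn_sum_activity c)%:num = 0 ->
  forall A, urn_sum_repl c A = \d_(0 : zvec Q) A.
Proof. by case: c => c c0; apply: zpush_dirac0; exact: repl_inactive. Qed.

Definition urn_sum : urn R := Urn urn_sum_init supp inactive.

End UrnSum.

Section UrnProd.
Context (R : realType).
Variables U V : urn R.

Local Notation Q := (colour U * colour V)%type.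

Definition urn_prod_repl (c : Q) : probability (zvec Q) R :=
  zmixture (activity c.1) (activity c.2)
    (zpush (fun k => (k, c.2)) (repl c.1))
    (zpush (fun k => (c.1, k)) (repl c.2)).

Definition urn_prod_activity (c : Q) : {nonneg R} :=
  ((activity c.1)%:num + (activity c.2)%:num)%:nng.

Definition urn_prod_init (c : Q) : nat := (init c.1 * init c.2)%N.

Let supp c :
  urn_prod_repl c [set x : zvec Q | forall d, - (c == d)%:Z <= x d] = 1%E.
Proof.
case: c => i j; set S := (X in _ X = _).
have Ui : zpush (fun k => (k, j)) (repl i) S = 1%E.
  by apply: (@zpush_supp _ _ Q) (repl_supp i) => ? ? [].
have Vj : zpush (fun k => (i, k)) (repl j) S = 1%E.
  by apply: (@zpush_supp _ _ Q) (repl_supp j) => ? ? [].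
rewrite /urn_prod_repl /= /zmixture; case: ifP => [ab0|_].
  rewrite [X in (_ * X + _)%E]Ui [X in (_ + _ * X)%E]Vj !mule1 -EFinD.
  by rewrite -mulrDl divff// gt_eqF.
rewrite diracE mem_set//= => d.
by rewrite ffunE oppr_le0.
Qed.

Let inactive c : (urn_prod_activity c)%:num = 0 ->
  forall A, urn_prod_repl c A = \d_(0 : zvec Q) A.
Proof. by move=> /= c0 A; rewrite /urn_prod_repl /zmixture c0 ltxx. Qed.

Definition urn_prod : urn R := Urn urn_prod_init supp inactive.

End UrnProd.

Record intmat (R : realType) := IntMat {
  im_size : nat;
  im_mx : 'M[R]_im_size;
  im_ge0 : forall i j, i != j -> 0 <= im_mx i j }.

Definition perm_similar (R : realType) (B C : intmat R) : Prop :=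
  exists (e : im_size B = im_size C) (P : 'M[R]_(im_size C)),
    is_perm_mx P /\ im_mx C = invmx P *m castmx (e, e) (im_mx B) *m P.

Definition IntMat_p (R : realType) : Type := quot (@perm_similar R).

Definition intmat_class (R : realType) (A : intmat R) : IntMat_p R :=
  cls (@perm_similar R) A.

Section DirectSum.
Context (R : realType).
Variables A B : intmat R.

Let dsum : 'M[R]_(im_size A + im_size B) := block_mx (im_mx A) 0 0 (im_mx B).

Let dsum_ge0 i j : i != j -> 0 <= dsum i j.
Proof.
rewrite /dsum.
case: (split_ordP i) => i' ->; case: (split_ordP j) => j' -> ij.
- rewrite block_mxEul; apply: im_ge0; apply: contraNneq ij => ->//.
- by rewrite block_mxEur mxE.
- by rewrite block_mxEdl mxE.
- rewrite block_mxEdr; apply: im_ge0; apply: contraNneq ij => ->//.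
Qed.

Definition direct_sum : intmat R := IntMat dsum_ge0.

End DirectSum.

Section KroneckerSum.
Context (R : realType).
Variables A B : intmat R.

Let ksum : 'M[R]_(im_size A * im_size B) :=
  tensmx (im_mx A) 1%:M + tensmx 1%:M (im_mx B).

Let ksum_ge0 i j : i != j -> 0 <= ksum i j.
Proof.
rewrite /ksum mxE.
case: (mxtens_indexP i) => i1 i2; case: (mxtens_indexP j) => j1 j2.
rewrite !tensmxE !mxE; have [<-|ij1] := eqVneq i1 j1.
  have [<-|ij2] := eqVneq i2 j2; first by rewrite eqxx.
  by rewrite mulr0 add0r mul1r im_ge0.
rewrite mul0r addr0 mulr_ge0//; exact: im_ge0.
Qed.

Definition kronecker_sum : intmat R := IntMat ksum_ge0.

End KroneckerSum.

(* Replacement measures may have infinite expectation, in which case there is no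
   real intensity matrix. *)
Definition finite_mean (R : realType) (U : urn R) : Prop :=
  forall i j : colour U,
    (repl i).-integrable setT (fun x : zvec (colour U) => ((x j)%:~R : R)%:E).

Definition PUfin (R : realType) : Type :=
  {C : PU R | exists2 U, C = urn_class U & finite_mean U}.

(* [e] is an enumeration of the colours. *)
Section IntensityMatrix.
Context (R : realType).
Variables (U : urn R) (n : nat) (e : 'I_n -> colour U).

Definition intensity_mx : 'M[R]_n := \matrix_(i, j)
  ((activity (e j))%:num *
   fine 'E_(repl (e j))[fun x : zvec (colour U) => (x (e i))%:~R]).

(* [fine +oo = 0], so no integrability is needed here. *)
Lemma intensity_mx_ge0 : injective e ->
  forall i j, i != j -> 0 <= intensity_mx i j.
Proof.
move=> eI i j ij; rewrite mxE mulr_ge0// fine_ge0// unlock.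
set S := [set x : zvec (colour U) | forall k, - (e j == k)%:Z <= x k].
rewrite (@ae_eq_integral _ _ _ _ _
  (fun x : zvec (colour U) => `|((x (e i))%:~R : R)%:E|%E))//.
  exact: integral_ge0.
exists (~` S); split => //.
  have mS : measurable S by [].
  by apply: etrans (probability_setC (repl (e j)) mS) _; rewrite repl_supp subee.
move=> x /= xP Sx; apply: xP => _; congr EFin; rewrite ger0_norm// ler0z.
by have := Sx (e i); rewrite (inj_eq eI) eq_sym (negbTE ij) oppr0.
Qed.

Definition intensity_matrix (eI : injective e) : intmat R :=
  IntMat (intensity_mx_ge0 eI).

End IntensityMatrix.

Definition fmSet (R : realType) : Type := {mset R[i]}%mset.

Fact minkowski_key : unit. Proof. exact: tt. Qed.

(* The finite set in the first line contains the support of the function. *)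
Definition minkowski_sum (R : realType) (m m' : fmSet R) : fmSet R :=
  [fsfun[minkowski_key] z in
     [fset (w + w')%R | w in finsupp m, w' in finsupp m']%fset
   => (\sum_(w <- finsupp m) m w * m' (z - w)%R)%N].

(* Main.v *)
Require Import Defs.
From HB Require Import structures.
From mathcomp Require Import all_boot all_order all_algebra perm.
From mathcomp Require Import finmap multiset.
From mathcomp Require Import all_classical all_reals all_analysis.
From mathcomp Require Import measurable_realfun.
From mathcomp Require Import complex mxtens mxred spectral.
Set Implicit Arguments.
Unset Strict Implicit.
Unset Printing Implicit Defensive.
Import Order.TTheory GRing.Theory Num.Theory.
Local Open Scope ring_scope.

(** Urns and intensity matrices are, up to renaming, data indexed by a finite
    set: the colours, or the rows of the matrix. In both cases addition is built
    on the disjoint union of the index sets and multiplication on their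
    cartesian product, so every semiring law comes from the corresponding
    bijection between sums and products of types ([sumA_bij], ...,
    [prodDl_bij]); it remains to see that the data agree along it.

    For urns the replacement measures of a product are normalised mixtures, with
    an exception at total activity 0, and are awkward to compare. The
    unnormalised measures [rate i = a_i mu_i] carry the same information
    ([strict_isoP]), since inactive colours have Dirac measures, and are simply
    additive under products ([rate_prod]). The laws are then equalities between
    composites of index maps.

    For matrices, [represents A M] says that [A] is the matrix of a function [M]
    on a finite type in some enumeration. A matrix representing [M] is unique up
    to permutation similarity, direct sums represent [dsum_fun] and Kronecker
    sums represent [ksum_fun], for which the laws are immediate.

    The entries of an intensity matrix are [a_j] times a mean, that is, an
    integral against a rate; so the additivity of the rates turns the product of
    urns into the Kronecker sum ([intensity_prod]). The Kronecker deltas appear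
    because a replacement in a product caused by one factor fixes the colour in
    the other factor. This needs the means to be finite, which is preserved by
    all operations ([PUfin_semiring]).

    Finite multisets are handled through sequences enumerating them. The number
    of times that [z] occurs in a Minkowski sum is the number of pairs with sum
    [z] ([minkowskiE]), which makes the laws a matter of reordering sums.

    Finally, the spectrum of a direct sum follows from the determinant of a
    block matrix. For a Kronecker sum, conjugate both factors to triangular
    form: the Kronecker sum of triangular matrices is triangular in the
    lexicographic order, with the pairwise sums of the diagonal entries on its
    diagonal ([eigenvalues_ksum]). *)

(** * Semirings of equivalence classes and subsemirings *)

Section Quotient.
Context (T : Type) (e : T -> T -> Prop).
Hypotheses (e_refl : forall x, e x x) (e_sym : forall x y, e x y -> e y x)
  (e_trans : forall x y z, e x y -> e y z -> e x z).

Lemma cls_eq x y : e x y -> cls e x = cls e y.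
Proof.
move=> exy; apply: eq_exist => /=; apply/funext => z; apply/propext; split.
  exact/e_trans/e_sym.
exact/e_trans.
Qed.

Lemma cls_inj x y : cls e x = cls e y -> e x y.
Proof. by move=> [] ->; exact: e_refl. Qed.

Lemma cls_surj (C : quot e) : exists x, C = cls e x.
Proof. by case: C => C /= [x Cx]; exists x; apply: eq_exist. Qed.

Definition quot_rep (C : quot e) : T := sval (cid (cls_surj C)).

Lemma cls_rep C : cls e (quot_rep C) = C.
Proof. by rewrite /quot_rep; case: cid => x /= ->. Qed.

Lemma e_rep x : e (quot_rep (cls e x)) x.
Proof. by apply: cls_inj; rewrite cls_rep. Qed.

Definition lift2 (op : T -> T -> T) (C D : quot e) : quot e :=
  cls e (op (quot_rep C) (quot_rep D)).

Lemma lift2E op :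
  (forall x x' y y', e x x' -> e y y' -> e (op x y) (op x' y')) ->
  forall x y, lift2 op (cls e x) (cls e y) = cls e (op x y).
Proof. by move=> opW x y; apply/cls_eq/opW; exact: e_rep. Qed.

(** The operations act on chosen representatives; as they respect [e], this
    choice is invisible and each axiom only has to hold up to [e]. *)
Lemma quot_semiring (add mul : T -> T -> T) (zero one : T) :
  (forall x x' y y', e x x' -> e y y' -> e (add x y) (add x' y')) ->
  (forall x x' y y', e x x' -> e y y' -> e (mul x y) (mul x' y')) ->
  (forall x y z, e (add x (add y z)) (add (add x y) z)) ->
  (forall x y, e (add x y) (add y x)) ->
  (forall x, e (add zero x) x) ->
  (forall x y z, e (mul x (mul y z)) (mul (mul x y) z)) ->
  (forall x y, e (mul x y) (mul y x)) ->
  (forall x, e (mul one x) x) ->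
  (forall x y z, e (mul (add x y) z) (add (mul x z) (mul y z))) ->
  (forall x, e (mul zero x) zero) ->
  exists S : comm_semiring (quot e),
    [/\ forall x y, sadd S (cls e x) (cls e y) = cls e (add x y),
        forall x y, smul S (cls e x) (cls e y) = cls e (mul x y),
        szero S = cls e zero & sone S = cls e one].
Proof.
move=> addW mulW addA addC add0 mulA mulC mul1 mulDl mul0.
have addE := lift2E addW; have mulE := lift2E mulW.
unshelve eexists (@CommSemiring (quot e) (lift2 add) (lift2 mul)
  (cls e zero) (cls e one) _ _ _ _ _ _ _ _).
- move=> C D E; rewrite -(cls_rep C) -(cls_rep D) -(cls_rep E) !addE.
  exact: cls_eq.
- by move=> C D; apply: cls_eq.
- by move=> C; rewrite -(cls_rep C) addE; exact: cls_eq.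
- move=> C D E; rewrite -(cls_rep C) -(cls_rep D) -(cls_rep E) !mulE.
  exact: cls_eq.
- by move=> C D; apply: cls_eq.
- by move=> C; rewrite -(cls_rep C) mulE; exact: cls_eq.
- move=> C D E; rewrite -(cls_rep C) -(cls_rep D) -(cls_rep E).
  by rewrite !(addE, mulE); exact: cls_eq.
- by move=> C; rewrite -(cls_rep C) mulE; exact: cls_eq.
- by split.
Qed.

End Quotient.

(** The inclusion of the subsemiring is injective, so stating that it is a
    morphism determines the operations. *)
Lemma sub_semiring (T : Type) (S : comm_semiring T) (P : T -> Prop) :
  (forall x y, P x -> P y -> P (sadd S x y)) ->
  (forall x y, P x -> P y -> P (smul S x y)) ->
  P (szero S) -> P (sone S) ->
  exists SP : comm_semiring {x | P x}, semiring_morphism SP S (fun x => sval x).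
Proof.
move=> PD PM P0 P1.
pose add (x y : {x | P x}) : {x | P x} :=
  exist _ _ (PD _ _ (svalP x) (svalP y)).
pose mul (x y : {x | P x}) : {x | P x} :=
  exist _ _ (PM _ _ (svalP x) (svalP y)).
unshelve eexists (@CommSemiring {x | P x} add mul
  (exist _ _ P0) (exist _ _ P1) _ _ _ _ _ _ _ _); last by split.
- by move=> x y z; apply: eq_exist => /=; exact: saddA.
- by move=> x y; apply: eq_exist => /=; exact: saddC.
- by move=> [x Px]; apply: eq_exist => /=; exact: sadd0.
- by move=> x y z; apply: eq_exist => /=; exact: smulA.
- by move=> x y; apply: eq_exist => /=; exact: smulC.
- by move=> [x Px]; apply: eq_exist => /=; exact: smul1.
- by move=> x y z; apply: eq_exist => /=; exact: smulDl.
- by move=> [x Px]; apply: eq_exist => /=; exact: smul0.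
Qed.

(** * The semiring laws of sums and products of types *)

Section TypeBijections.
Context (A B C : Type).

Definition sumA (x : A + (B + C)) : (A + B) + C :=
  match x with
  | inl a => inl (inl a)
  | inr (inl b) => inl (inr b)
  | inr (inr c) => inr c
  end.

Lemma sumA_bij : bijective sumA.
Proof.
exists (fun x => match x with inl (inl a) => inl a | inl (inr b) => inr (inl b)
                            | inr c => inr (inr c) end).
  by move=> [a|[b|c]].
by move=> [[a|b]|c].
Qed.

Definition sumC (x : A + B) : B + A :=
  match x with inl a => inr a | inr b => inl b end.

Lemma sumC_bij : bijective sumC.
Proof.
by exists (fun x => match x with inl a => inr a | inr b => inl b end) => [][].
Qed.

Definition sum0 (x : void + A) : A :=
  match x with inl v => match v with end | inr a => a end.

Lemma sum0_bij : bijective sum0.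
Proof. by exists inr => // -[[]|]. Qed.

Definition prodA (x : A * (B * C)) : (A * B) * C := (x.1, x.2.1, x.2.2).

Lemma prodA_bij : bijective prodA.
Proof.
by exists (fun x => (x.1.1, (x.1.2, x.2))); [move=> [a [b c]]|move=> [[a b] c]].
Qed.

Definition prodC (x : A * B) : B * A := (x.2, x.1).

Lemma prodC_bij : bijective prodC.
Proof. by exists (fun x => (x.2, x.1)) => -[]. Qed.

Lemma prod1_bij : bijective (@snd unit A).
Proof. by exists (pair tt) => // -[[]]. Qed.

Definition prodDl (x : (A + B) * C) : (A * C) + (B * C) :=
  match x.1 with inl a => inl (a, x.2) | inr b => inr (b, x.2) end.

Lemma prodDl_bij : bijective prodDl.
Proof.
exists (fun x => match x with inl y => (inl y.1, y.2)
                            | inr y => (inr y.1, y.2) end).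
  by move=> [[a|b] c].
by move=> [[a c]|[b c]].
Qed.

Lemma prod0_bij : bijective (@fst void A).
Proof. by exists (fun v : void => match v with end) => [[[]]|[]]. Qed.

End TypeBijections.

Section BijectionCongruence.
Context (A A' B B' : Type) (f : A -> A') (g : B -> B').
Hypotheses (fB : bijective f) (gB : bijective g).

Definition sum_map (x : A + B) : A' + B' :=
  match x with inl a => inl (f a) | inr b => inr (g b) end.

Lemma sum_map_bij : bijective sum_map.
Proof.
have [f' fK f'K] := fB; have [g' gK g'K] := gB.
exists (fun x => match x with inl a => inl (f' a) | inr b => inr (g' b) end).
  by move=> [a|b] /=; rewrite ?fK ?gK.
by move=> [a|b] /=; rewrite ?f'K ?g'K.
Qed.

Definition prod_map (x : A * B) : A' * B' := (f x.1, g x.2).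

Lemma prod_map_bij : bijective prod_map.
Proof.
have [f' fK f'K] := fB; have [g' gK g'K] := gB.
exists (fun x => (f' x.1, g' x.2)).
  by move=> [a b]; rewrite /prod_map /= fK gK.
by move=> [a b]; rewrite /prod_map /= f'K g'K.
Qed.

End BijectionCongruence.

(** * The semiring of urns *)

Lemma zmap_id (Q : finType) : @zmap Q Q id = id.
Proof. by apply/funext => x; apply/ffunP => j; rewrite ffunE big_pred1_eq. Qed.

Lemma zmap_comp (Q Q' Q'' : finType) (f : Q' -> Q'') (g : Q -> Q') :
  zmap f \o zmap g = zmap (f \o g).
Proof.
apply/funext => x; apply/ffunP => k; rewrite !ffunE /=.
rewrite (partition_big g (fun j => f j == k)) //=; apply: eq_bigr => j /eqP jk.
rewrite ffunE; apply: eq_bigl => i.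
by have [->|] := eqVneq (g i) j; rewrite ?andbF// jk eqxx.
Qed.

Lemma preimage_zmap (Q Q' Q'' : finType) (f : Q' -> Q'') (g : Q -> Q') A :
  (zmap g @^-1` (zmap f @^-1` A) = zmap (f \o g) @^-1` A)%classic.
Proof. by rewrite -comp_preimage zmap_comp. Qed.

Section Rate.
Context (R : realType).
Implicit Types U V W : urn R.

(** The intensity with which a ball of colour [i] triggers a replacement in [A].
    Unlike the replacement measures of a product, which are mixtures with
    normalised weights and a separate rule for total activity zero, these
    unnormalised measures simply add up under products. *)
Definition rate U (i : colour U) (A : set (zvec (colour U))) : R :=
  (activity i)%:num * fine (repl i A).

Lemma repl_fine U (i : colour U) A : repl i A = (fine (repl i A))%:E.
Proof. by rewrite fineK// fin_num_measure. Qed.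

Lemma rate_sum_inl U V (i : colour U) A :
  @rate (urn_sum U V) (inl i) A = rate i (zmap inl @^-1` A)%classic.
Proof. by []. Qed.

Lemma rate_sum_inr U V (j : colour V) A :
  @rate (urn_sum U V) (inr j) A = rate j (zmap inr @^-1` A)%classic.
Proof. by []. Qed.

(** Multiplying by the total activity cancels the normalisation of the mixture;
    if the total activity is 0, both summands vanish as well. *)
Lemma rate_prod U V (c : colour U * colour V) A :
  @rate (urn_prod U V) c A =
  rate c.1 (zmap (fun k => (k, c.2)) @^-1` A)%classic +
  rate c.2 (zmap (fun k => (c.1, k)) @^-1` A)%classic.
Proof.
rewrite /rate /= /zmixture.
have a0 : 0 <= (activity c.1)%:num by [].
have b0 : 0 <= (activity c.2)%:num by [].
move: a0 b0; set a := (activity c.1)%:num; set b := (activity c.2)%:num.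
move=> a0 b0; rewrite -/a -/b.
have [ab0|] := ltP 0 (a + b).
  have mixE (p q : \bar R) : p = (fine p)%:E -> q = (fine q)%:E ->
      (a + b) * fine ((a / (a + b))%:E * p + (b / (a + b))%:E * q)%E =
      a * fine p + b * fine q.
    move=> -> -> /=; rewrite mulrDr !mulrA ![(a + b) * _]mulrC.
    by rewrite !mulfK// gt_eqF.
  by apply: mixE; exact: repl_fine.
move=> ab0; have /andP[/eqP -> /eqP ->] : (a == 0) && (b == 0).
  by rewrite -paddr_eq0// eq_le ab0 addr_ge0.
by rewrite addr0 !mul0r addr0.
Qed.

(** The rates determine the replacement measures of the active colours; those of
    the inactive colours are all Dirac at 0. *)
Lemma strict_isoP U V : strict_iso U V <->
  exists2 phi : colour U -> colour V, bijective phi &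
    forall i, [/\ forall A, rate (phi i) A = rate i (zmap phi @^-1` A)%classic,
                  (activity (phi i))%:num = (activity i)%:num
                & init (phi i) = init i].
Proof.
split=> -[phi phiB UV]; exists phi => // i; have [UVr UVa UVi] := UV i.
  by split=> // A; rewrite /rate UVr UVa.
split=> // A; have [a0|a0] := eqVneq (activity i)%:num 0.
  rewrite (repl_inactive (etrans UVa a0)).
  by rewrite (zpush_dirac0 phi (repl_inactive a0)).
(* The rates of [i] and [phi i] have the same nonzero weight. *)
have /(mulfI a0) UVA : (activity i)%:num * fine (repl (phi i) A) =
    (activity i)%:num * fine (zpush phi (repl i) A).
  by rewrite -{1}UVa; exact: UVr.
by rewrite repl_fine UVA fineK// /zpush /pushforward fin_num_measure.
Qed.

Lemma strict_iso_refl U : strict_iso U U.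
Proof.
apply/strict_isoP; exists id; first by exists id.
by move=> i; split=> // A; rewrite zmap_id.
Qed.

Lemma strict_iso_sym U V : strict_iso U V -> strict_iso V U.
Proof.
move=> /strict_isoP[phi [psi phiK psiK] UV]; apply/strict_isoP.
exists psi; first by exists phi.
move=> j; have [UVr UVa UVi] := UV (psi j); rewrite psiK in UVr UVa UVi.
split=> // A; rewrite UVr preimage_zmap.
by rewrite (_ : psi \o phi = id) ?zmap_id//; exact/funext.
Qed.

Lemma strict_iso_trans U V W :
  strict_iso U V -> strict_iso V W -> strict_iso U W.
Proof.
move=> /strict_isoP[phi phiB UV] /strict_isoP[psi psiB VW]; apply/strict_isoP.
exists (psi \o phi); first exact: bij_comp.
move=> i; have [UVr UVa UVi] := UV i; have [VWr VWa VWi] := VW (phi i).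
split=> [A||]; rewrite /= ?VWa ?VWi//.
by rewrite VWr UVr preimage_zmap.
Qed.

Lemma urn_sum_iso U U' V V' : strict_iso U U' -> strict_iso V V' ->
  strict_iso (urn_sum U V) (urn_sum U' V').
Proof.
move=> /strict_isoP[f fB UU'] /strict_isoP[g gB VV']; apply/strict_isoP.
exists (sum_map f g) => [|[i|j]]; first exact: sum_map_bij.
- have [UUr UUa UUi] := UU' i; split=> // A.
  by rewrite rate_sum_inl rate_sum_inl UUr !preimage_zmap.
- have [VVr VVa VVi] := VV' j; split=> // A.
  by rewrite rate_sum_inr rate_sum_inr VVr !preimage_zmap.
Qed.

Lemma urn_prod_iso U U' V V' : strict_iso U U' -> strict_iso V V' ->
  strict_iso (urn_prod U V) (urn_prod U' V').
Proof.
move=> /strict_isoP[f fB UU'] /strict_isoP[g gB VV']; apply/strict_isoP.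
exists (prod_map f g) => [|[i j]]; first exact: prod_map_bij.
have [UUr UUa UUi] := UU' i; have [VVr VVa VVi] := VV' j.
split=> [A||] /=; last 2 first.
- by rewrite UUa VVa.
- by rewrite /urn_prod_init /= UUi VVi.
by rewrite !rate_prod /= UUr VVr !preimage_zmap.
Qed.

Lemma void_repl_supp (i : void) :
  \d_(0 : zvec void) [set x : zvec void | forall j, - (i == j)%:Z <= x j] =
  1%E :> \bar R.
Proof. by case: i. Qed.

Lemma unit_repl_supp (i : unit) :
  \d_(0 : zvec unit) [set x : zvec unit | forall j, - (i == j)%:Z <= x j] =
  1%E :> \bar R.
Proof. by rewrite diracE mem_set//= => j; rewrite ffunE oppr_le0. Qed.

Definition urn0 : urn R :=
  @Urn R void (fun=> \d_(0 : zvec void)) (fun=> 0%:nng) (fun=> 0%N)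
    void_repl_supp (fun _ _ _ => erefl).

(** Its only colour is inactive, so a product with it keeps all activities and
    rates, and its single ball keeps the initial configuration. *)
Definition urn1 : urn R :=
  @Urn R unit (fun=> \d_(0 : zvec unit)) (fun=> 0%:nng) (fun=> 1%N)
    unit_repl_supp (fun _ _ _ => erefl).

Lemma urn_sumA U V W :
  strict_iso (urn_sum U (urn_sum V W)) (urn_sum (urn_sum U V) W).
Proof.
apply/strict_isoP; exists (@sumA _ _ _); first exact: sumA_bij.
by move=> [i|[i|i]]; split=> // A;
  rewrite !(rate_sum_inl, rate_sum_inr) !preimage_zmap.
Qed.

Lemma urn_sumC U V : strict_iso (urn_sum U V) (urn_sum V U).
Proof.
apply/strict_isoP; exists (@sumC _ _); first exact: sumC_bij.
by move=> [i|i]; split=> // A;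
  rewrite !(rate_sum_inl, rate_sum_inr) !preimage_zmap.
Qed.

Lemma urn_sum0 U : strict_iso (urn_sum urn0 U) U.
Proof.
apply/strict_isoP; exists (@sum0 _); first exact: sum0_bij.
move=> [[]|i]; split=> // A.
by rewrite rate_sum_inr preimage_zmap (_ : _ \o _ = id)// zmap_id.
Qed.

Lemma urn_prodA U V W :
  strict_iso (urn_prod U (urn_prod V W)) (urn_prod (urn_prod U V) W).
Proof.
apply/strict_isoP; exists (@prodA _ _ _); first exact: prodA_bij.
move=> [i [j k]]; split=> [A||] /=.
- by rewrite !rate_prod /= ?rate_prod /= !preimage_zmap addrA.
- by rewrite addrA.
- by rewrite /urn_prod_init /= mulnA.
Qed.

Lemma urn_prodC U V : strict_iso (urn_prod U V) (urn_prod V U).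
Proof.
apply/strict_isoP; exists (@prodC _ _); first exact: prodC_bij.
move=> [i j]; split=> [A||] /=.
- by rewrite !rate_prod /= !preimage_zmap addrC.
- by rewrite addrC.
- by rewrite /urn_prod_init /= mulnC.
Qed.

Lemma urn_prod1 U : strict_iso (urn_prod urn1 U) U.
Proof.
apply/strict_isoP; exists snd; first exact: prod1_bij.
move=> [[] i]; split=> [A||] /=.
- rewrite rate_prod /= [X in X + _]mul0r add0r preimage_zmap.
  by rewrite (_ : _ \o _ = id)// zmap_id.
- by rewrite add0r.
- by rewrite /urn_prod_init /= mul1n.
Qed.

Lemma urn_prodDl U V W : strict_iso (urn_prod (urn_sum U V) W)
  (urn_sum (urn_prod U W) (urn_prod V W)).
Proof.
apply/strict_isoP; exists (@prodDl _ _ _); first exact: prodDl_bij.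
move=> [[i|i] k]; split=> // A.
- apply: etrans (@rate_prod U W (i, k) _) _; rewrite [RHS]rate_prod /=.
  by rewrite [X in _ = X + _]rate_sum_inl !preimage_zmap.
- apply: etrans (@rate_prod V W (i, k) _) _; rewrite [RHS]rate_prod /=.
  by rewrite [X in _ = X + _]rate_sum_inr !preimage_zmap.
Qed.

Lemma urn_prod0 U : strict_iso (urn_prod urn0 U) urn0.
Proof.
by apply/strict_isoP; exists fst => [|[[]]]; exact: prod0_bij.
Qed.

Lemma PU_semiring : exists S : comm_semiring (PU R),
  [/\ forall U V, sadd S (urn_class U) (urn_class V) = urn_class (urn_sum U V),
      forall U V, smul S (urn_class U) (urn_class V) = urn_class (urn_prod U V),
      szero S = urn_class urn0 & sone S = urn_class urn1].
Proof.
apply: quot_semiring.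
- exact: strict_iso_refl.
- exact: strict_iso_sym.
- exact: strict_iso_trans.
- by move=> *; exact: urn_sum_iso.
- by move=> *; exact: urn_prod_iso.
- exact: urn_sumA.
- exact: urn_sumC.
- exact: urn_sum0.
- exact: urn_prodA.
- exact: urn_prodC.
- exact: urn_prod1.
- exact: urn_prodDl.
- exact: urn_prod0.
Qed.

End Rate.

(** * The semiring of intensity matrices *)

Lemma invmx_perm (F : comUnitRingType) n (s : 'S_n) :
  invmx (perm_mx s) = perm_mx s^-1%g :> 'M[F]_n.
Proof.
rewrite -[RHS](mulKmx (unitmx_perm F s)) -perm_mxM mulgV perm_mx1.
by rewrite mulmx1.
Qed.

Section IndexedMatrices.
Context (R : realType).
Implicit Types A B C : intmat R.

Lemma perm_similarP A B : perm_similar A B <->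
  exists2 f : 'I_(im_size A) -> 'I_(im_size B), bijective f &
    forall i j, im_mx B (f i) (f j) = im_mx A i j.
Proof.
case: A B => [n A A0] [m B B0]; rewrite /perm_similar /=; split.
  move=> [e]; case: m / e => /= in B B0 *.
  move=> [P [/is_perm_mxP[s ->]]].
  rewrite invmx_perm castmx_id.
  rewrite -[s in X in _ *m X]invgK -row_permE -col_permE => BE.
  exists s; first by exists (s^-1)%g; [exact: permK|exact: permKV].
  by move=> i j; rewrite BE !mxE !permK.
move=> [f fB BE]; have mn : n = m.
  by rewrite -(card_ord n) -(card_ord m); exact: bij_eq_card fB.
case: m / mn => /= in B B0 f fB BE *; exists erefl.
pose s := perm (bij_inj fB); exists (perm_mx s); split.
  exact: perm_mx_is_perm.
rewrite invmx_perm castmx_id.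
rewrite -[s in X in _ *m X]invgK -row_permE -col_permE.
apply/matrixP => i j; rewrite !mxE -BE.
by rewrite -[f _](permE (bij_inj fB)) -[f _ in RHS](permE (bij_inj fB)) !permKV.
Qed.

(** A matrix with rows and columns indexed by an arbitrary finite type: the
    index types of sums and products are then sums and products of types, and
    the semiring laws follow from the same bijections as for urns. *)
Definition represents A (T : Type) (M : T -> T -> R) :=
  exists2 e : 'I_(im_size A) -> T, bijective e &
    forall i j, M (e i) (e j) = im_mx A i j.

Lemma represents_im_mx A : represents A (im_mx A).
Proof. by exists id => //; exists id. Qed.

Lemma eq_represents (T : Type) A (M N : T -> T -> R) :
  M =2 N -> represents A N -> represents A M.
Proof. by move=> MN [e eB AN]; exists e => // i j; rewrite MN AN. Qed.

(** Composing [f] with the two enumerations permutes rows and columns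
    simultaneously. *)
Lemma represents_similar (T T' : Type) A B (M : T -> T -> R) (N : T' -> T' -> R)
    (f : T -> T') :
  represents A M -> represents B N -> bijective f ->
  (forall i j, N (f i) (f j) = M i j) -> perm_similar A B.
Proof.
move=> [d dB AM] [e [e' eK e'K] BN] fB MN; apply/perm_similarP.
exists (e' \o (f \o d)).
  by apply: bij_comp; [exists e|exact: bij_comp].
by move=> i j; rewrite -BN /= !e'K MN AM.
Qed.

Lemma perm_similar_represents (T : Type) A B (M : T -> T -> R) :
  perm_similar A B -> represents B M -> represents A M.
Proof.
move=> /perm_similarP[f fB AB] [e eB BM].
by exists (e \o f) => [|i j]; [exact: bij_comp|rewrite BM AB].
Qed.

Section Operations.
Context (T T' : eqType) (M : T -> T -> R) (N : T' -> T' -> R).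

Definition dsum_fun (x y : T + T') : R :=
  match x, y with
  | inl i, inl j => M i j
  | inr i, inr j => N i j
  | _, _ => 0
  end.

Definition ksum_fun (x y : T * T') : R :=
  M x.1 y.1 * (x.2 == y.2)%:R + (x.1 == y.1)%:R * N x.2 y.2.

Lemma represents_dsum A B : represents A M -> represents B N ->
  represents (direct_sum A B) dsum_fun.
Proof.
move=> [d dB AM] [e eB BN]; exists (sum_map d e \o @fintype.split _ _).
  apply: bij_comp; first exact: sum_map_bij.
  by exists (@unsplit _ _); [exact: splitK|exact: unsplitK].
have splitl i : fintype.split (lshift (im_size B) i) = inl i.
  exact: unsplitK (inl i).
have splitr i : fintype.split (rshift (im_size A) i) = inr i.
  exact: unsplitK (inr i).
move=> i j /=; case: (split_ordP i) => i' ->; case: (split_ordP j) => j' ->;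
  rewrite ?splitl ?splitr /=.
- by rewrite block_mxEul AM.
- by rewrite block_mxEur mxE.
- by rewrite block_mxEdl mxE.
- by rewrite block_mxEdr BN.
Qed.

Lemma represents_ksum A B : represents A M -> represents B N ->
  represents (kronecker_sum A B) ksum_fun.
Proof.
move=> [d dB AM] [e eB BN]; exists (prod_map d e \o @mxtens_unindex _ _).
  apply: bij_comp; first exact: prod_map_bij.
  by exists (@mxtens_index _ _);
    [exact: mxtens_unindexK|exact: mxtens_indexK].
move=> i j /=; case: (mxtens_indexP i) => i1 i2.
case: (mxtens_indexP j) => j1 j2; rewrite !mxtens_indexK /ksum_fun /= AM BN.
rewrite mxE !tensmxE !mxE.
by rewrite (inj_eq (bij_inj dB)) (inj_eq (bij_inj eB)).
Qed.

End Operations.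

Lemma perm_similar_refl A : perm_similar A A.
Proof. by apply/perm_similarP; exists id => //; exists id. Qed.

Lemma perm_similar_sym A B : perm_similar A B -> perm_similar B A.
Proof.
move=> /perm_similarP[f [g fK gK] AB]; apply/perm_similarP.
by exists g => [|i j]; [exists f|rewrite -AB !gK].
Qed.

Lemma perm_similar_trans A B C :
  perm_similar A B -> perm_similar B C -> perm_similar A C.
Proof.
move=> /perm_similarP[f fB AB] /perm_similarP[g gB BC]; apply/perm_similarP.
by exists (g \o f) => [|i j]; [exact: bij_comp|rewrite BC AB].
Qed.

Lemma represents_unique (T : Type) A B (M : T -> T -> R) :
  represents A M -> represents B M -> perm_similar A B.
Proof.
by move=> AM BM; apply: (represents_similar (f := id) AM BM) => //; exists id.
Qed.

Lemma direct_sum_similar A A' B B' : perm_similar A A' -> perm_similar B B' ->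
  perm_similar (direct_sum A B) (direct_sum A' B').
Proof.
move=> AA BB; apply: (@represents_unique _ _ _
    (dsum_fun (im_mx A') (im_mx B'))); apply: represents_dsum;
  exact: represents_im_mx || exact/perm_similar_represents/represents_im_mx.
Qed.

Lemma kronecker_sum_similar A A' B B' :
  perm_similar A A' -> perm_similar B B' ->
  perm_similar (kronecker_sum A B) (kronecker_sum A' B').
Proof.
move=> AA BB; apply: (@represents_unique _ _ _
    (ksum_fun (im_mx A') (im_mx B'))); apply: represents_ksum;
  exact: represents_im_mx || exact/perm_similar_represents/represents_im_mx.
Qed.

Lemma zero_mx_ge0 n (i j : 'I_n) : i != j -> 0 <= (0 : 'M[R]_n) i j.
Proof. by rewrite mxE. Qed.

Definition intmat0 : intmat R := IntMat (@zero_mx_ge0 0).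
Definition intmat1 : intmat R := IntMat (@zero_mx_ge0 1).

Lemma represents0 (M : void -> void -> R) : represents intmat0 M.
Proof.
exists (fun i : 'I_0 => match notF (valP i) with end) => [|[]//].
by exists (fun v : void => match v with end) => -[].
Qed.

Lemma represents1 : represents intmat1 (fun _ _ : unit => 0).
Proof.
exists (fun=> tt) => [|i j]; last by rewrite mxE.
by exists (fun=> ord0) => [i|[]] //; exact/esym/ord1.
Qed.

Lemma direct_sumA A B C : perm_similar
  (direct_sum A (direct_sum B C)) (direct_sum (direct_sum A B) C).
Proof.
have rA := represents_im_mx A; have rB := represents_im_mx B.
have rC := represents_im_mx C.
apply: (represents_similar (represents_dsum rA (represents_dsum rB rC))
  (represents_dsum (represents_dsum rA rB) rC) (sumA_bij _ _ _)).
by move=> [i|[i|i]] [j|[j|j]].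
Qed.

Lemma direct_sumC A B : perm_similar (direct_sum A B) (direct_sum B A).
Proof.
have rA := represents_im_mx A; have rB := represents_im_mx B.
apply: (represents_similar (represents_dsum rA rB) (represents_dsum rB rA)
  (sumC_bij _ _)).
by move=> [i|i] [j|j].
Qed.

Lemma direct_sum0 A : perm_similar (direct_sum intmat0 A) A.
Proof.
have rA := represents_im_mx A; have r0 := represents0 (fun _ _ => 0).
apply: (represents_similar (represents_dsum r0 rA) rA (sum0_bij _)).
by move=> [[]|i] [[]|j].
Qed.

Lemma kronecker_sumA A B C : perm_similar
  (kronecker_sum A (kronecker_sum B C)) (kronecker_sum (kronecker_sum A B) C).
Proof.
have rA := represents_im_mx A; have rB := represents_im_mx B.
have rC := represents_im_mx C.
apply: (represents_similar (represents_ksum rA (represents_ksum rB rC))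
  (represents_ksum (represents_ksum rA rB) rC) (prodA_bij _ _ _)).
move=> [i [j k]] [i' [j' k']]; rewrite /ksum_fun /= !xpair_eqE.
rewrite !mulrDl !mulrDr -!mulnb !natrM addrA.
by rewrite !mulrA -!(mulrA (im_mx A i i')) (mulrC (j == j')%:R).
Qed.

Lemma kronecker_sumC A B :
  perm_similar (kronecker_sum A B) (kronecker_sum B A).
Proof.
have rA := represents_im_mx A; have rB := represents_im_mx B.
apply: (represents_similar (represents_ksum rA rB) (represents_ksum rB rA)
  (prodC_bij _ _)).
move=> [i j] [i' j']; rewrite /ksum_fun /= addrC.
by rewrite mulrC [X in _ + X]mulrC.
Qed.

Lemma kronecker_sum1 A : perm_similar (kronecker_sum intmat1 A) A.
Proof.
have rA := represents_im_mx A; have r1 := represents1.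
apply: (represents_similar (represents_ksum r1 rA) rA (prod1_bij _)).
by move=> [[] i] [[] j]; rewrite /ksum_fun /= mul0r add0r mul1r.
Qed.

Lemma kronecker_sumDl A B C : perm_similar (kronecker_sum (direct_sum A B) C)
  (direct_sum (kronecker_sum A C) (kronecker_sum B C)).
Proof.
have rA := represents_im_mx A; have rB := represents_im_mx B.
have rC := represents_im_mx C.
apply: (represents_similar (represents_ksum (represents_dsum rA rB) rC)
  (represents_dsum (represents_ksum rA rC) (represents_ksum rB rC))
  (prodDl_bij _ _ _)).
by move=> [[i|i] k] [[j|j] l]; rewrite /ksum_fun /= ?mul0r ?addr0.
Qed.

Lemma kronecker_sum0 A : perm_similar (kronecker_sum intmat0 A) intmat0.
Proof.
have rA := represents_im_mx A; have r0 := represents0 (fun _ _ => 0).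
apply: (represents_similar (represents_ksum r0 rA) r0 (prod0_bij _)).
by move=> [[]].
Qed.

Lemma IntMat_semiring : exists S : comm_semiring (IntMat_p R),
  [/\ forall A B, sadd S (intmat_class A) (intmat_class B) =
        intmat_class (direct_sum A B),
      forall A B, smul S (intmat_class A) (intmat_class B) =
        intmat_class (kronecker_sum A B),
      szero S = intmat_class intmat0 & sone S = intmat_class intmat1].
Proof.
apply: quot_semiring.
- exact: perm_similar_refl.
- exact: perm_similar_sym.
- exact: perm_similar_trans.
- by move=> *; exact: direct_sum_similar.
- by move=> *; exact: kronecker_sum_similar.
- exact: direct_sumA.
- exact: direct_sumC.
- exact: direct_sum0.
- exact: kronecker_sumA.
- exact: kronecker_sumC.
- exact: kronecker_sum1.
- exact: kronecker_sumDl.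
- exact: kronecker_sum0.
Qed.

End IndexedMatrices.

(** * Intensity matrices of urns *)

Lemma zmap_in (Q Q' : finType) (phi : Q -> Q') (x : zvec Q) k :
  injective phi -> zmap phi x (phi k) = x k.
Proof.
by move=> phiI; rewrite ffunE (big_pred1 k)// => i; rewrite (inj_eq phiI).
Qed.

Lemma zmap_notin (Q Q' : finType) (phi : Q -> Q') (x : zvec Q) l :
  (forall k, phi k != l) -> zmap phi x l = 0.
Proof. by move=> phil; rewrite ffunE big_pred0// => k; exact/negbTE. Qed.

Section Means.
Context (R : realType).
Local Open Scope ereal_scope.

Definition coordinate (Q : finType) (j : Q) (x : zvec Q) : \bar R :=
  ((x j)%:~R : R)%:E.

Definition mean (Q : finType) (mu : probability (zvec Q) R) (j : Q) : R :=
  fine (\int[mu]_x coordinate j x).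

Definition mean_finite (Q : finType) (mu : probability (zvec Q) R) : Prop :=
  forall j, mu.-integrable setT (coordinate j).

Lemma eq_measure_integrable d (T : measurableType d)
    (m1 m2 : {measure set T -> \bar R}) (f : T -> \bar R) :
  m1 =1 m2 -> m1.-integrable setT f -> m2.-integrable setT f.
Proof.
move=> m12 /integrableP[mf fi]; apply/integrableP; split => //.
by rewrite (eq_measure_integral m1)// => A _ _; exact/esym/m12.
Qed.

Section Pushforward.
Context (Q Q' : finType) (phi : Q -> Q') (mu : probability (zvec Q) R).
Hypothesis phiI : injective phi.

Let mphi : measurable_fun setT (zmap phi : zvec Q -> zvec Q').
Proof. by []. Qed.

Lemma coordinate_zmap_in k : coordinate (phi k) \o zmap phi = coordinate k.
Proof. by apply/funext => x /=; rewrite /coordinate zmap_in. Qed.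

Lemma coordinate_zmap_notin l : (forall k, phi k != l) ->
  coordinate l \o zmap phi = cst 0.
Proof.
by move=> phil; apply/funext => x /=; rewrite /coordinate zmap_notin.
Qed.

Lemma integral_zpush (f : zvec Q' -> \bar R) :
  mu.-integrable setT (f \o zmap phi) ->
  \int[zpush phi mu]_x f x = \int[mu]_x (f \o zmap phi) x.
Proof.
move=> fi; have mf : measurable_fun setT f by [].
by rewrite -(integral_pushforward mphi mf (D := setT)).
Qed.

(** Injectivity makes each coordinate of the image either a coordinate of the
    argument or zero. *)
Lemma mean_finite_zpush : mean_finite mu -> mean_finite (zpush phi mu).
Proof.
move=> mu_fin l.
have mf : measurable_fun setT (coordinate l : zvec Q' -> _) by [].
suff fi : mu.-integrable setT (coordinate l \o zmap phi).
  exact: (@integrable_pushforward _ _ _ _ _ _ mphi mu setT _ mf).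
have [k /eqP <-|phil] := pickP (fun k => phi k == l).
  by rewrite coordinate_zmap_in; exact: mu_fin.
by rewrite coordinate_zmap_notin ?integrable0// => k; rewrite phil.
Qed.

Lemma mean_zpush_in k : mean_finite mu ->
  mean (zpush phi mu) (phi k) = mean mu k.
Proof.
move=> mu_fin; rewrite /mean integral_zpush coordinate_zmap_in//; exact: mu_fin.
Qed.

Lemma mean_zpush_notin l : (forall k, phi k != l) ->
  mean (zpush phi mu) l = 0%R.
Proof.
move=> phil; rewrite /mean integral_zpush coordinate_zmap_notin//.
  by rewrite integral0.
exact: integrable0.
Qed.

End Pushforward.

Lemma integrable_mscale d (T : measurableType d) (p : {nonneg R})
    (m : {measure set T -> \bar R}) (f : T -> \bar R) :
  m.-integrable setT f -> (mscale p m).-integrable setT f.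
Proof.
move=> /integrableP[mf fi]; apply/integrableP; split => //.
rewrite ge0_integral_mscale//; last exact: measurableT_comp.
by rewrite lte_mul_pinfty// ?lee_fin.
Qed.

Lemma integral_mscale d (T : measurableType d) (p : {nonneg R})
    (m : {measure set T -> \bar R}) (f : T -> \bar R) :
  m.-integrable setT f ->
  \int[mscale p m]_x f x = p%:num%:E * \int[m]_x f x.
Proof.
move=> fi; have mf := measurable_int _ fi.
rewrite [LHS]integralE [X in _ * X]integralE muleBr//; last first.
  by rewrite fin_num_adde_defl// fin_numN integrable_neg_fin_num.
rewrite (ge0_integral_mscale _ measurableT p (measurable_funepos mf))//.
by rewrite (ge0_integral_mscale _ measurableT p (measurable_funeneg mf)).
Qed.

Lemma integrable_measure_add d (T : measurableType d)
    (m1 m2 : {measure set T -> \bar R}) (f : T -> \bar R) :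
  m1.-integrable setT f -> m2.-integrable setT f ->
  (measure_add m1 m2).-integrable setT f.
Proof.
move=> /integrableP[mf fi1] /integrableP[_ fi2]; apply/integrableP; split=> //.
rewrite ge0_integral_measure_add//; last exact: measurableT_comp.
exact: lte_add_pinfty.
Qed.

Section Mixture.
Context (Q : finType) (a b : {nonneg R}) (mu nu : probability (zvec Q) R).
Hypotheses (mu_fin : mean_finite mu) (nu_fin : mean_finite nu).

Let p_ge0 : (0 <= a%:num / (a%:num + b%:num))%R.
Proof. by rewrite divr_ge0. Qed.

Let q_ge0 : (0 <= b%:num / (a%:num + b%:num))%R.
Proof. by rewrite divr_ge0. Qed.

Let mix := measure_add (mscale (NngNum p_ge0) mu) (mscale (NngNum q_ge0) nu).

Let zmixtureE : (0 < a%:num + b%:num)%R -> zmixture a b mu nu =1 mix.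
Proof. by move=> ab0 A; rewrite /zmixture ab0 /mix measure_addE. Qed.

Let zmixture_dirac : ~~ (0 < a%:num + b%:num)%R ->
  zmixture a b mu nu =1 \d_(0%R : zvec Q).
Proof. by move=> /negbTE ab0 A; rewrite /zmixture ab0. Qed.

Lemma mean_finite_zmixture : mean_finite (zmixture a b mu nu).
Proof.
move=> j; have [ab0|ab0] := boolP (0 < a%:num + b%:num)%R.
  apply: (@eq_measure_integrable _ _ mix).
    by move=> A; exact/esym/zmixtureE.
  by apply: integrable_measure_add; apply: integrable_mscale.
apply: (@eq_measure_integrable _ _ (\d_(0%R : zvec Q))).
  by move=> A; exact/esym/zmixture_dirac.
apply/integrableP; split => //.
by rewrite integral_dirac// diracT mul1e ltry.
Qed.

(** The mean of a mixture, in the unnormalised form of [rate_prod]. *)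
Lemma mean_zmixture j : ((a%:num + b%:num) * mean (zmixture a b mu nu) j =
  a%:num * mean mu j + b%:num * mean nu j)%R.
Proof.
have [ab0|] := boolP (0 < a%:num + b%:num)%R; last first.
  rewrite -leNgt => ab0.
  have /andP[/eqP -> /eqP ->] : (a%:num == 0)%R && (b%:num == 0)%R.
    by rewrite -paddr_eq0// eq_le ab0 addr_ge0.
  by rewrite addr0 !mul0r addr0.
rewrite /mean (eq_measure_integral mix) => [|A _ _]; last exact: zmixtureE.
rewrite integral_measure_add//; [|exact: integrable_mscale..].
rewrite !integral_mscale// fineD ?fin_numM ?integrable_fin_num//.
rewrite !fineM ?integrable_fin_num//=.
rewrite mulrDr !mulrA ![((_ + _) * _)%R]mulrC.
by rewrite !mulfK// gt_eqF.
Qed.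

End Mixture.

(** The intensity matrix indexed by the colours themselves: the mean rate at
    which one ball of colour [j] produces balls of colour [i]. *)
Definition intensity (U : urn R) (i j : colour U) : R :=
  ((activity j)%:num * mean (repl j) i)%R.

Lemma represents_intensity (U : urn R) n (e : 'I_n -> colour U)
    (eB : bijective e) :
  represents (intensity_matrix (bij_inj eB)) (@intensity U).
Proof.
by exists e => // i j; rewrite mxE /intensity /mean unlock.
Qed.

Lemma finite_mean_sum (U V : urn R) :
  finite_mean U -> finite_mean V -> finite_mean (urn_sum U V).
Proof.
move=> Ufin Vfin [i|i]; apply: mean_finite_zpush; do ?[exact: Ufin|exact: Vfin].
  by move=> ? ? [].
by move=> ? ? [].
Qed.

Lemma finite_mean_prod (U V : urn R) :
  finite_mean U -> finite_mean V -> finite_mean (urn_prod U V).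
Proof.
move=> Ufin Vfin [i j]; apply: mean_finite_zmixture;
  apply: mean_finite_zpush; do ?[exact: Ufin|exact: Vfin].
  by move=> ? ? [].
by move=> ? ? [].
Qed.

Lemma intensity_sum (U V : urn R) : finite_mean U -> finite_mean V ->
  @intensity (urn_sum U V) =2 dsum_fun (@intensity U) (@intensity V).
Proof.
move=> Ufin Vfin.
have inlI : injective (@inl (colour U) (colour V)) by move=> ? ? [].
have inrI : injective (@inr (colour U) (colour V)) by move=> ? ? [].
move=> [i|i] [j|j]; rewrite /intensity /=.
- by rewrite (mean_zpush_in inlI _ (Ufin j)).
- by rewrite mean_zpush_notin ?mulr0.
- by rewrite mean_zpush_notin ?mulr0.
- by rewrite (mean_zpush_in inrI _ (Vfin j)).
Qed.

(** A replacement at [(i, j)] caused by [i] only affects the colours [(k, j)],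
    and one caused by [j] only affects the colours [(i, l)]. *)
Lemma intensity_prod (U V : urn R) : finite_mean U -> finite_mean V ->
  @intensity (urn_prod U V) =2 ksum_fun (@intensity U) (@intensity V).
Proof.
move=> Ufin Vfin [k l] [i j].
have lI : injective (fun h : colour U => (h, j)) by move=> ? ? [].
have rI : injective (fun h : colour V => (i, h)) by move=> ? ? [].
have lfin := mean_finite_zpush lI (Ufin i).
have rfin := mean_finite_zpush rI (Vfin j).
rewrite /ksum_fun /intensity /=.
apply: etrans (mean_zmixture _ _ lfin rfin _) _.
congr (_ + _)%R.
  have [->|lj] := eqVneq l j.
    by rewrite mulr1 (mean_zpush_in lI _ (Ufin i)).
  rewrite mulr0 mean_zpush_notin ?mulr0// => h.
  by rewrite xpair_eqE negb_and (eq_sym j) lj orbT.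
have [->|ki] := eqVneq k i.
  by rewrite mul1r (mean_zpush_in rI _ (Vfin j)).
rewrite mul0r mean_zpush_notin ?mulr0// => h.
by rewrite xpair_eqE negb_and (eq_sym i) ki.
Qed.

Lemma intensity_iso (U V : urn R) : strict_iso U V -> finite_mean U ->
  exists2 phi : colour U -> colour V, bijective phi &
    forall i j, @intensity V (phi i) (phi j) = @intensity U i j.
Proof.
move=> [phi phiB UV] Ufin; exists phi => // i j; have [UVr UVa _] := UV j.
rewrite /intensity UVa; congr (_ * _)%R.
rewrite -[RHS](mean_zpush_in (bij_inj phiB) i (Ufin j)).
by congr fine; apply: eq_measure_integral => A _ _; exact: UVr.
Qed.

End Means.
(** * The semiring of finite multisets *)

Section Multisets.
Context (R : realType).
Local Open Scope mset_scope.
Implicit Types (m n p : {mset R[i]}) (F : R[i] -> nat) (z : R[i]).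

Lemma sum_seq_mset F (s : seq R[i]) :
  (\sum_(w <- seq_mset s) F w = \sum_(w <- s) F w)%N.
Proof. exact: (perm_big _ (perm_eq_seq_mset s)). Qed.

Lemma count_mem_sum z (s : seq R[i]) :
  (count_mem z s = \sum_(w <- s) (w == z))%N.
Proof.
by rewrite -sum1_count big_mkcond; apply: eq_bigr => w _ /=; case: (w == z).
 Qed.

Lemma msetD_seq m n : m `+` n = seq_mset (m ++ n).
Proof.
by apply/msetP => z; rewrite mset_seqE count_cat !count_mem_mset msetE2.
Qed.

(** The number of pairs with sum [z]: unlike the definition, a form in which the
    two arguments play symmetric roles. *)
Lemma minkowskiE m n z : minkowski_sum m n z =
  (\sum_(w <- m) \sum_(w' <- n) (w + w' == z)%R)%N.
Proof.
rewrite sum_mset fsfunE.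
have nE w : n (z - w)%R = (\sum_(w' <- n) (w + w' == z)%R)%N.
  rewrite -count_mem_mset count_mem_sum; apply: eq_bigr => w' _.
  by rewrite -subr_eq opprK addrC.
(* Outside the support bound no pair has sum [z]. *)
case: ifPn => [_|zS]; first by apply: eq_bigr => w _; rewrite nE.
rewrite big1_seq// => w /andP[_ wm].
rewrite big1_seq ?muln0// => w' /andP[_ w'n].
have [ww'z|//] := eqVneq; case/negP: zS; rewrite -ww'z.
apply/imfset2P; exists w => //; exists w' => //.
by rewrite msuppE.
Qed.

Lemma minkowski_seq m n :
  minkowski_sum m n = seq_mset [seq (w + w')%R | w <- m, w' <- n].
Proof.
apply/msetP => z; rewrite mset_seqE minkowskiE count_mem_sum.
by rewrite big_allpairs_dep.
Qed.

Lemma sum_minkowski F m n : (\sum_(z <- (minkowski_sum m n : {mset R[i]})) F z =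
  \sum_(w <- m) \sum_(w' <- n) F (w + w')%R)%N.
Proof. by rewrite minkowski_seq sum_seq_mset big_allpairs_dep. Qed.

Lemma minkowski_sumA : associative (@minkowski_sum R).
Proof.
move=> m n p; apply/msetP => z; rewrite !minkowskiE sum_minkowski.
apply: eq_bigr => a _; rewrite sum_minkowski; apply: eq_bigr => b _.
by apply: eq_bigr => c _; rewrite addrA.
Qed.

Lemma minkowski_sumC : commutative (@minkowski_sum R).
Proof.
move=> m n; apply/msetP => z; rewrite !minkowskiE exchange_big /=.
by apply: eq_bigr => b _; apply: eq_bigr => a _; rewrite addrC.
Qed.

Lemma minkowski_sum1 : left_id [mset (0 : R[i])%R] (@minkowski_sum R).
Proof.
move=> m; apply/msetP => z; rewrite minkowskiE enum_msetn big_seq1.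
by rewrite -count_mem_mset count_mem_sum; apply: eq_bigr => w _; rewrite add0r.
Qed.

Lemma minkowski_sumDl : left_distributive (@minkowski_sum R) (@msetD _).
Proof.
move=> m n p; apply/msetP => z; rewrite msetE2 !minkowskiE msetD_seq.
by rewrite sum_seq_mset big_cat.
Qed.

Lemma minkowski_sum0 : left_zero mset0 (@minkowski_sum R).
Proof.
by move=> m; apply/msetP => z; rewrite minkowskiE big_mset0 mset0E.
Qed.

Definition fmSet_semiring : comm_semiring (fmSet R) :=
  CommSemiring (@msetDA _) (@msetDC _) (@mset0D _) minkowski_sumA
    minkowski_sumC minkowski_sum1 minkowski_sumDl minkowski_sum0.

End Multisets.

(** * Spectra of direct sums and Kronecker sums *)

Section CharPoly.
Context (F : comNzRingType).

(** [P'] is the inverse of [P]; an explicit inverse is easier to come by than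
    invertibility when [P] is a tensor product. *)
Lemma char_poly_similar n (P P' A : 'M[F]_n) :
  P *m P' = 1%:M -> char_poly (P *m A *m P') = char_poly A.
Proof.
move=> PP'; rewrite /char_poly /char_poly_mx.
pose p := map_mx polyC P; pose p' := map_mx polyC P'.
have pp' : p *m p' = 1%:M by rewrite -map_mxM PP' map_mx1.
rewrite (_ : _ - _ = p *m ('X%:M - map_mx polyC A) *m p'); last first.
  rewrite mulmxBr mulmxBl !map_mxM; congr (_ - _).
  by rewrite scalar_mxC -mulmxA pp' mulmx1.
by rewrite !det_mulmx mulrAC -det_mulmx pp' det1 mul1r.
Qed.

Lemma char_poly_block n m (A : 'M[F]_n) (B : 'M[F]_m) :
  char_poly (block_mx A 0 0 B) = char_poly A * char_poly B.
Proof.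
rewrite /char_poly /char_poly_mx map_block_mx !map_mx0 scalar_mx_block.
by rewrite opp_block_mx add_block_mx !subr0 det_ublock.
Qed.

Definition ksum_mx n m (A : 'M[F]_n) (B : 'M[F]_m) : 'M[F]_(n * m) :=
  tensmx A 1%:M + tensmx 1%:M B.

Lemma tensmx11 n m : tensmx 1%:M 1%:M = 1%:M :> 'M[F]_(n * m).
Proof.
apply/matrixP => i j; case: (mxtens_indexP i) => i1 i2.
case: (mxtens_indexP j) => j1 j2; rewrite tensmxE !mxE.
rewrite (inj_eq (can_inj (@mxtens_indexK _ _))) xpair_eqE.
by rewrite -natrM mulnb.
Qed.

Lemma ksum_mx_similar n m (P P' A : 'M[F]_n) (Q Q' B : 'M[F]_m) :
  P *m P' = 1%:M -> Q *m Q' = 1%:M ->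
  ksum_mx (P *m A *m P') (Q *m B *m Q') =
  tensmx P Q *m ksum_mx A B *m tensmx P' Q'.
Proof.
move=> PP' QQ'; rewrite /ksum_mx mulmxDr mulmxDl !tensmx_mul !mulmx1.
by rewrite PP' QQ'.
Qed.

(** [mxtens_index] orders the pairs lexicographically: if [(i1, i2)] comes
    before [(j1, j2)], then either [i1 < j1], or [i1 = j1] and [i2 < j2]. *)
Lemma ksum_mx_trig n m (A : 'M[F]_n) (B : 'M[F]_m) :
  is_trig_mx A -> is_trig_mx B -> is_trig_mx (ksum_mx A B).
Proof.
move=> /is_trig_mxP At /is_trig_mxP Bt; apply/is_trig_mxP => i j.
case: (mxtens_indexP i) => i1 i2; case: (mxtens_indexP j) => j1 j2.
move=> /= lt_ij; rewrite mxE !tensmxE !mxE.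
have [lt1|lt1|/val_inj eq1] := ltngtP i1 j1.
- by rewrite At// -[i1 == j1]val_eqE (ltn_eqF lt1) !mul0r addr0.
- have := leq_mul lt1 (leqnn m); rewrite mulSn => le1.
  suff : (j1 * m + j2 < i1 * m + i2)%N by rewrite ltnNge (ltnW lt_ij).
  apply: (@leq_trans (m + j1 * m)); last exact: leq_trans (leq_addr _ _).
  by rewrite addnC ltn_add2r.
- rewrite eq1 ltn_add2l in lt_ij.
  by rewrite -[i2 == j2]val_eqE (ltn_eqF lt_ij) Bt// !mulr0 addr0.
Qed.

Lemma char_poly_ksum_trig n m (A : 'M[F]_n) (B : 'M[F]_m) :
  is_trig_mx A -> is_trig_mx B -> char_poly (ksum_mx A B) =
  \prod_(i < n) \prod_(j < m) ('X - (A i i + B j j)%:P).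
Proof.
move=> At Bt; rewrite char_poly_trig ?ksum_mx_trig// pair_bigA /=.
rewrite (reindex (@mxtens_index n m)) /=; last first.
  by exists (@mxtens_unindex n m) => k _;
    [exact: mxtens_indexK|exact: mxtens_unindexK].
apply: eq_bigr => -[i j] _; rewrite mxE !tensmxE !mxE !eqxx.
by rewrite mulr1 mul1r.
Qed.

End CharPoly.

Section Eigenvalues.
Context (F : numClosedFieldType).

Lemma trigonalization n (A : 'M[F]_n) :
  exists P P' T : 'M[F]_n, [/\ P *m P' = 1%:M, is_trig_mx T & A = P *m T *m P'].
Proof.
case: n A => [|n] A.
  exists 1%:M, 1%:M, A; split; rewrite ?mulmx1 ?mul1mx//.
  by apply/is_trig_mxP => -[].
have [//|P /unitarymx_unit Pu] := Schur A.
rewrite /similar_to conjumx// => PAt.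
exists (invmx P), P, (P *m A *m invmx P); split=> //; first exact: mulVmx.
by rewrite !mulmxA mulVmx// mul1mx -mulmxA mulVmx// mulmx1.
Qed.

Definition eigenvalues n (A : 'M[F]_n) : seq F :=
  sval (closed_field_poly_normal (char_poly A)).

Lemma char_poly_eigenvalues n (A : 'M[F]_n) :
  char_poly A = \prod_(z <- eigenvalues A) ('X - z%:P).
Proof.
rewrite /eigenvalues; case: closed_field_poly_normal => s /= {1}->.
by rewrite (monicP (char_poly_monic A)) scale1r.
Qed.

Lemma eigenvalues_perm n (A : 'M[F]_n) s :
  char_poly A = \prod_(z <- s) ('X - z%:P) -> perm_eq (eigenvalues A) s.
Proof. by move=> As; apply: prod_XsubC_eq; rewrite -char_poly_eigenvalues. Qed.

Lemma count_eigenvalues n (A : 'M[F]_n) z :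
  count_mem z (eigenvalues A) = mup z (char_poly A).
Proof. by rewrite char_poly_eigenvalues mu_prod_XsubC. Qed.

Lemma eigenvalues_block n m (A : 'M[F]_n) (B : 'M[F]_m) :
  perm_eq (eigenvalues (block_mx A 0 0 B)) (eigenvalues A ++ eigenvalues B).
Proof.
apply: eigenvalues_perm.
by rewrite char_poly_block big_cat -!char_poly_eigenvalues.
Qed.

(** Similar factors have similar Kronecker sums, so both factors may be taken
    triangular; their eigenvalues are then the diagonal entries. *)
Lemma eigenvalues_ksum n m (A : 'M[F]_n) (B : 'M[F]_m) :
  perm_eq (eigenvalues (ksum_mx A B))
    [seq x + y | x <- eigenvalues A, y <- eigenvalues B].
Proof.
have [P [P' [T [PP' Tt AE]]]] := trigonalization A.
have [Q [Q' [S [QQ' St BE]]]] := trigonalization B.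
have eigA : perm_eq (eigenvalues A) [seq T i i | i <- enum 'I_n].
  apply: eigenvalues_perm; rewrite AE char_poly_similar// char_poly_trig//.
  by rewrite big_map big_enum.
have eigB : perm_eq (eigenvalues B) [seq S i i | i <- enum 'I_m].
  apply: eigenvalues_perm; rewrite BE char_poly_similar// char_poly_trig//.
  by rewrite big_map big_enum.
apply: eigenvalues_perm; rewrite AE BE ksum_mx_similar// char_poly_similar.
  rewrite char_poly_ksum_trig// big_allpairs_dep -AE -BE (perm_big _ eigA).
  rewrite big_map big_enum /=; apply: eq_bigr => i _.
  by rewrite (perm_big _ eigB) big_map big_enum.
by rewrite tensmx_mul PP' QQ' tensmx11.
Qed.

End Eigenvalues.

Section Spectrum.
Context (R : realType).
Implicit Types A B : intmat R.

Definition complex_mx A : 'M[R[i]]_(im_size A) :=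
  map_mx (real_complex R) (im_mx A).

Definition spectrum A : fmSet R := seq_mset (eigenvalues (complex_mx A)).

Lemma spectrumE A z : spectrum A z = mup z (char_poly (complex_mx A)).
Proof. by rewrite mset_seqE count_eigenvalues. Qed.

Lemma spectrum_similar A B : perm_similar A B -> spectrum A = spectrum B.
Proof.
case: A B => [n A A0] [m B B0] [/= e]; case: m / e => /= in B B0 *.
move=> [P [/is_perm_mxP[s ->]]]; rewrite castmx_id => BE.
apply/msetP => z; rewrite !spectrumE /complex_mx /= BE !map_mxM.
rewrite char_poly_similar// -map_mxM mulVmx ?map_mx1//.
exact: unitmx_perm.
Qed.

Lemma spectrum_direct_sum A B :
  spectrum (direct_sum A B) = msetD (spectrum A) (spectrum B).
Proof.
transitivity (seq_mset (eigenvalues (complex_mx A) ++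
  eigenvalues (complex_mx B))).
  apply/eq_seq_msetP; rewrite /complex_mx /= map_block_mx !map_mx0.
  exact: eigenvalues_block.
by apply/msetP => z; rewrite msetE2 !mset_seqE count_cat.
Qed.

Lemma spectrum_kronecker_sum A B :
  spectrum (kronecker_sum A B) = minkowski_sum (spectrum A) (spectrum B).
Proof.
transitivity (seq_mset [seq x + y | x <- eigenvalues (complex_mx A),
                                     y <- eigenvalues (complex_mx B)]).
  apply/eq_seq_msetP; rewrite /complex_mx /= map_mxD !map_mxT !map_mx1.
  exact: eigenvalues_ksum.
apply/msetP => z; rewrite minkowskiE sum_seq_mset mset_seqE count_mem_sum.
rewrite big_allpairs_dep; apply: eq_bigr => x _.
by rewrite sum_seq_mset.
Qed.

Lemma spectrum0 : spectrum (intmat0 R) = mset0.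
Proof.
apply/msetP => z; rewrite spectrumE mset0E /char_poly det_mx00.
by rewrite mupNroot// root1.
Qed.

Lemma spectrum1 : spectrum (intmat1 R) = msetn 1 0%R.
Proof.
apply/msetP => z; rewrite spectrumE msetnE char_poly_trig; last first.
  by apply/is_trig_mxP => i j _; rewrite !mxE rmorph0.
rewrite big_ord1 !mxE rmorph0.
by rewrite -[_ - _]expr1 mup_XsubCX eq_sym.
Qed.

End Spectrum.

(** * The morphisms *)

Section Morphisms.
Context (R : realType).

Lemma finite_mean_urn1 : finite_mean (urn1 R).
Proof.
move=> i j; apply/integrableP; split => //.
by rewrite integral_dirac// diracT mul1e ltry.
Qed.

Lemma urn_class_iso (U V : urn R) : urn_class U = urn_class V -> strict_iso U V.
Proof. exact: (cls_inj (@strict_iso_refl R)). Qed.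

Section Phi.
Variables (SPU : comm_semiring (PU R)) (SIM : comm_semiring (IntMat_p R)).
Hypotheses
  (SPUD : forall U V : urn R,
     sadd SPU (urn_class U) (urn_class V) = urn_class (urn_sum U V))
  (SPUM : forall U V : urn R,
     smul SPU (urn_class U) (urn_class V) = urn_class (urn_prod U V))
  (SPU0 : szero SPU = urn_class (urn0 R))
  (SPU1 : sone SPU = urn_class (urn1 R))
  (SIMD : forall A B : intmat R,
     sadd SIM (intmat_class A) (intmat_class B) = intmat_class (direct_sum A B))
  (SIMM : forall A B : intmat R,
     smul SIM (intmat_class A) (intmat_class B) =
     intmat_class (kronecker_sum A B))
  (SIM0 : szero SIM = intmat_class (intmat0 R))
  (SIM1 : sone SIM = intmat_class (intmat1 R)).

Lemma PUfin_semiring : exists SPUfin : comm_semiring (PUfin R),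
  semiring_morphism SPUfin SPU (fun C : PUfin R => sval C).
Proof.
apply: sub_semiring.
- move=> _ _ [U -> Ufin] [V -> Vfin]; exists (urn_sum U V); first exact: SPUD.
  exact: finite_mean_sum.
- move=> _ _ [U -> Ufin] [V -> Vfin]; exists (urn_prod U V); first exact: SPUM.
  exact: finite_mean_prod.
- by exists (urn0 R) => // -[].
- by exists (urn1 R) => //; exact: finite_mean_urn1.
Qed.

Definition urn_of (C : PUfin R) : urn R := s2val (cid2 (svalP C)).

Lemma urn_ofE C : sval C = urn_class (urn_of C).
Proof. exact: s2valP (cid2 (svalP C)). Qed.

Lemma urn_of_finite C : finite_mean (urn_of C).
Proof. exact: s2valP' (cid2 (svalP C)). Qed.

Definition some_intensity_matrix (U : urn R) : intmat R :=
  intensity_matrix (bij_inj (enum_val_bij (colour U))).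

Definition Phi (C : PUfin R) : IntMat_p R :=
  intmat_class (some_intensity_matrix (urn_of C)).

(** An isomorphism of urns transports the intensities, and all enumerations give
    similar matrices; so the value of [Phi] does not depend on the choice of the
    urn and of the enumeration of its colours. *)
Lemma PhiE C U A : sval C = urn_class U -> represents A (@intensity R U) ->
  Phi C = intmat_class A.
Proof.
rewrite urn_ofE => /urn_class_iso CU AU.
have [phi phiB phiE] := intensity_iso CU (urn_of_finite (C := C)).
apply: (cls_eq (@perm_similar_sym R) (@perm_similar_trans R)).
exact: represents_similar (represents_intensity _) AU phiB phiE.
Qed.

Lemma Phi_morphism (SPUfin : comm_semiring (PUfin R)) :
  semiring_morphism SPUfin SPU (fun C : PUfin R => sval C) ->
  semiring_morphism SPUfin SIM Phi.
Proof.
move=> [valD valM val0 val1].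
have rep C : represents (some_intensity_matrix (urn_of C)) 
    (@intensity R (urn_of C)) by exact: represents_intensity.
have fin C := urn_of_finite (C := C).
split=> [C D|C D||].
- rewrite SIMD; apply: PhiE; first by rewrite valD !urn_ofE SPUD.
  apply: (eq_represents (intensity_sum (fin C) (fin D))).
  exact: represents_dsum.
- rewrite SIMM; apply: PhiE; first by rewrite valM !urn_ofE SPUM.
  apply: (eq_represents (intensity_prod (fin C) (fin D))).
  exact: represents_ksum.
- by rewrite SIM0; apply: (@PhiE _ (urn0 R)); [rewrite val0|exact: represents0].
- rewrite SIM1; apply: (@PhiE _ (urn1 R)); first by rewrite val1 SPU1.
  by apply: eq_represents (@represents1 R) => i j; rewrite /intensity mul0r.
Qed.

End Phi.

Definition sigma (C : IntMat_p R) : fmSet R := spectrum (quot_rep C).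

Lemma sigmaE A : sigma (intmat_class A) = spectrum A.
Proof. exact/spectrum_similar/(e_rep (@perm_similar_refl R)). Qed.

End Morphisms.

Theorem theorem1 (R : realType) :
  exists (SPU : comm_semiring (PU R)) (SIM : comm_semiring (IntMat_p R))
         (SMS : comm_semiring (fmSet R)),
    ((forall U V : urn R,
        sadd SPU (urn_class U) (urn_class V) = urn_class (urn_sum U V)) /\
     (forall U V : urn R,
        smul SPU (urn_class U) (urn_class V) = urn_class (urn_prod U V))) /\
    ((forall A B : intmat R,
        sadd SIM (intmat_class A) (intmat_class B) =
        intmat_class (direct_sum A B)) /\
     (forall A B : intmat R,
        smul SIM (intmat_class A) (intmat_class B) =
        intmat_class (kronecker_sum A B))) /\
    ((forall m m' : fmSet R, sadd SMS m m' = msetD m m') /\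
     (forall m m' : fmSet R, smul SMS m m' = minkowski_sum m m')) /\
    exists (SPUfin : comm_semiring (PUfin R))
           (Phi : PUfin R -> IntMat_p R) (sigma : IntMat_p R -> fmSet R),
      semiring_morphism SPUfin SPU (fun C : PUfin R => sval C) /\
      semiring_morphism SPUfin SIM Phi /\
      (forall (C : PUfin R) (U : urn R) (n : nat) (e : 'I_n -> colour U)
              (eB : bijective e),
         sval C = urn_class U ->
         Phi C = intmat_class (intensity_matrix (bij_inj eB))) /\
      semiring_morphism SIM SMS sigma /\
      (forall (A : intmat R) (z : R[i]),
         sigma (intmat_class A) z =
         mup z (char_poly (map_mx (real_complex R) (im_mx A)))).
Proof.
have [SPU [SPUD SPUM SPU0 SPU1]] := PU_semiring R.
have [SIM [SIMD SIMM SIM0 SIM1]] := IntMat_semiring R.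
have [SPUfin val_morph] := PUfin_semiring SPUD SPUM SPU0 SPU1.
exists SPU, SIM, (fmSet_semiring R); split=> //; split=> //; split=> //.
exists SPUfin, (@Phi R), (@sigma R); split=> //; split.
  exact: Phi_morphism SPUD SPUM SPU0 SPU1 SIMD SIMM SIM0 SIM1 _ val_morph.
split.
  move=> C U n e eB CU; apply: (PhiE CU); exact: represents_intensity.
split; last by move=> A z; rewrite sigmaE spectrumE.
have surj := @cls_surj _ (@perm_similar R).
split=> [C D|C D||].
- have [A ->] := surj C; have [B ->] := surj D.
  by rewrite SIMD !sigmaE spectrum_direct_sum.
- have [A ->] := surj C; have [B ->] := surj D.
  by rewrite SIMM !sigmaE spectrum_kronecker_sum.
- by rewrite SIM0 sigmaE spectrum0.
- by rewrite SIM1 sigmaE spectrum1.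
Qed.
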